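(* Let $G$ be a graph with $n$ vertices and at least one edge, and let $D$ be the maximum degree of an edge of $G$. Then \[ \operatorname{pd}(S/I(G))\leq n\left(1-\frac {1}{D}\right). \]
   Context: All graphs are finite and simple. Let $S$ be the polynomial ring over a fixed field whose variables are the vertices of $G$, and let $I(G) = (xy : (x,y) \text{ is an edge of } G)\subset S$ be the edge ideal of $G$. For an edge $(x,y)$ of $G$, let $A=\{z : (x,z)\text{ and }(y,z)\text{ are edges of }G\}$; the degree of the edge $(x,y)$ is $\deg(x)+\deg(y)-|A|$ (equivalently, the number of vertices adjacent to $x$ or to $y$). $\operatorname{pd}$ denotes projective dimension over $S$. *)

(* Defs.v *)
From HB Require Import structures.
From mathcomp Require Import all_boot all_order all_algebra.
From mathcomp Require Import generic_quotient ring_quotient.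
From mathcomp Require Import boolp.
From mathcomp Require Import mpoly.

Set Implicit Arguments.
Unset Strict Implicit.
Unset Printing Implicit Defensive.

Import GRing.Theory.
Local Open Scope ring_scope.
Local Open Scope quotient_scope.

Section GeneratedSubmodule.
Variables (R : nzRingType) (V : lmodType R) (G : V -> Prop).

Definition gen_submod : {pred V} := [pred v : V |
  `[< exists s : seq (R * V), (forall a, a \in s -> G a.2) /\
        v = \sum_(a <- s) a.1 *: a.2 >]].

Lemma gen_submod_closed : submod_closed gen_submod.
Proof.
split; first by apply/asboolP; exists [::]; rewrite big_nil.
move=> c u v /asboolP[s [Gs ->]] /asboolP[t [Gt ->]]; apply/asboolP.
exists ([seq (c * a.1, a.2) | a <- s] ++ t); split.
  by move=> a; rewrite mem_cat => /orP[/mapP[b /Gs Gb ->]|/Gt].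
rewrite big_cat big_map scaler_sumr; congr (_ + _).
by apply: eq_bigr => a _; rewrite scalerA.
Qed.

HB.instance Definition _ := GRing.isSubmodClosed.Build R V gen_submod
  gen_submod_closed.

End GeneratedSubmodule.

(* The library's {ideal_quot submod_zmod} is only a Z-module, or a ring when I is an ideal. *)
Section QuotientModule.
Variables (R : nzRingType) (V : lmodType R) (I : submodClosed V).

Lemma submod_zmod_closed : zmod_closed I.
Proof.
split=> [|u v Iu Iv]; first exact: rpred0.
by rewrite -scaleN1r rpredD // rpredZ.
Qed.

Definition submod_zmod : zmodClosed V :=
  HB.pack (fun v : V => v \in I)
    (GRing.isZmodClosed.Build V (fun v : V => v \in I) submod_zmod_closed).

Definition quotmod : Type := {ideal_quot submod_zmod}.

HB.instance Definition _ := GRing.Zmodule.on quotmod.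

Definition quotmod_proj (v : V) : quotmod := \pi_({ideal_quot submod_zmod}) v.

Definition quotmod_scale (c : R) (x : quotmod) : quotmod :=
  quotmod_proj (c *: repr (x : {ideal_quot submod_zmod})).

Lemma quotmod_projP u v : quotmod_proj u = quotmod_proj v <-> u - v \in I.
Proof.
have -> : (u - v \in I) = (u - v \in submod_zmod) by [].
by rewrite Quotient.idealrBE; split=> /eqP.
Qed.

Lemma quotmod_proj_surj x : exists v, quotmod_proj v = x.
Proof. by exists (repr (x : {ideal_quot submod_zmod})); rewrite /quotmod_proj reprK. Qed.

Lemma quotmod_projB : zmod_morphism quotmod_proj.
Proof. exact: (pi_is_zmod_morphism {ideal_quot submod_zmod}). Qed.

HB.instance Definition _ :=
  GRing.isZmodMorphism.Build V quotmod quotmod_proj quotmod_projB.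

Lemma quotmod_projZ c v :
  quotmod_scale c (quotmod_proj v) = quotmod_proj (c *: v).
Proof.
apply/quotmod_projP; rewrite -scalerBr; apply: rpredZ.
by apply/quotmod_projP; rewrite /quotmod_proj reprK.
Qed.

Lemma quotmod_scaleA a b x :
  quotmod_scale a (quotmod_scale b x) = quotmod_scale (a * b) x.
Proof.
by have [v <-] := quotmod_proj_surj x; rewrite !quotmod_projZ scalerA.
Qed.

Lemma quotmod_scale1 : left_id 1 quotmod_scale.
Proof.
by move=> x; have [v <-] := quotmod_proj_surj x; rewrite quotmod_projZ scale1r.
Qed.

Lemma quotmod_scaleDr : right_distributive quotmod_scale +%R.
Proof.
move=> a x y; have [u <-] := quotmod_proj_surj x.
have [v <-] := quotmod_proj_surj y.
by rewrite -raddfD !quotmod_projZ -raddfD scalerDr.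
Qed.

Lemma quotmod_scaleDl x :
  {morph (fun a => quotmod_scale a x) : a b / a + b}.
Proof.
move=> a b /=; have [v <-] := quotmod_proj_surj x.
by rewrite !quotmod_projZ -raddfD scalerDl.
Qed.

HB.instance Definition _ := GRing.Zmodule_isLmodule.Build R quotmod
  quotmod_scaleA quotmod_scale1 quotmod_scaleDr quotmod_scaleDl.

Lemma quotmod_proj_scalable : scalable quotmod_proj.
Proof. by move=> c v; rewrite -quotmod_projZ. Qed.

HB.instance Definition _ :=
  GRing.isScalable.Build R V quotmod *:%R quotmod_proj quotmod_proj_scalable.

End QuotientModule.

Section ProjectiveDimension.
Variable R : nzRingType.

Definition projective (P : lmodType R) : Prop :=
  forall (A B : lmodType R) (f : {linear A -> B}) (g : {linear P -> B}),
    (forall b, exists a, f a = b) ->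
    exists h : {linear P -> A}, forall x, f (h x) = g x.

Record proj_resolution (M : lmodType R) := ProjResolution {
  res_mod : nat -> lmodType R;
  res_diff : forall i, {linear res_mod i.+1 -> res_mod i};
  res_aug : {linear res_mod 0 -> M};
  res_projective : forall i, projective (res_mod i);
  res_aug_surj : forall m, exists x, res_aug x = m;
  res_exact0 : forall x, res_aug x = 0 <-> exists y, res_diff 0 y = x;
  res_exactS : forall i x,
    res_diff i x = 0 <-> exists y, res_diff i.+1 y = x
}.

Definition res_length_le (M : lmodType R) (P : proj_resolution M) (n : nat) :
    Prop :=
  forall i, (n < i)%N -> forall x : res_mod P i, x = 0.

Definition proj_dim_le (M : lmodType R) (n : nat) : Prop :=
  exists P : proj_resolution M, res_length_le P n.

(* Holds for no n when M has infinite projective dimension; the zero module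
   gets projective dimension 0. *)
Definition is_proj_dim (M : lmodType R) (n : nat) : Prop :=
  proj_dim_le M n /\ forall m, proj_dim_le M m -> (n <= m)%N.

End ProjectiveDimension.

Section EdgeIdeal.
Variables (k : fieldType) (T : finType) (e : rel T).

Definition deg (x : T) : nat := #|[set z | e x z]|.

Definition edge_degree (x y : T) : nat :=
  (deg x + deg y - #|[set z | e x z && e y z]|)%N.

Definition max_edge_degree : nat :=
  \max_(p : T * T | e p.1 p.2) edge_degree p.1 p.2.

Definition vpoly : comNzRingType := {mpoly k[#|T|]}.

Definition vvar (x : T) : vpoly := 'X_(enum_rank x).

(* {mpoly k[_]} is canonically a k-module; vpoly^o is S as a module over
   itself. *)
Definition edge_ideal : submodClosed vpoly^o :=
  @gen_submod vpoly vpoly^o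
    (fun p => exists x y, e x y /\ p = vvar x * vvar y).

Definition edge_quot : lmodType vpoly := quotmod edge_ideal.

End EdgeIdeal.

(* Main.v *)
(** Let [D] bound the edge degrees.  For disjoint sets [Z] of "killed" and [W]
    of "live" vertices, [S / ((Z) + I(G[W]))] has projective dimension at most
    [|Z| + |W| (1 - 1/D)].  For a live vertex [x], the sequence
    [0 -> S/(I : x) -> S/I -> S/(I, x) -> 0] bounds the middle term by the
    larger of the outer two: [(I : x)] removes [x] for free and kills its live
    neighbours, [(I, x)] kills [x].
    Fix a live vertex [y] and apply this to its neighbours one after the other.
    A leaf of the resulting tree has lost a set of [m] vertices, of which all
    but one are killed: either the branch ends with the colon by a neighbour
    [x] of [y], and the lost vertices lie in [N(x) U N(y)], or all neighbours
    of [y] are killed, so that [y] is isolated and can be dropped.  In both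
    cases [m <= D], and [m - 1 <= m (1 - 1/D)], so induction on [|W|] applies. *)
Require Import Defs.
From HB Require Import structures.
(* [mpoly] comes before [all_boot] because it rebinds [symmetric]. *)
From mathcomp Require Import boolp mpoly.
From mathcomp Require Import all_boot all_order all_algebra.
From mathcomp Require Import zify.
Import GRing.Theory Num.Theory.
Local Open Scope ring_scope.

Set Implicit Arguments.
Unset Strict Implicit.
Unset Printing Implicit Defensive.

(** * Kernels of linear maps as modules *)

Section Kernel.
Variables (R : nzRingType) (A B : lmodType R) (f : {linear A -> B}).

Definition kernel_pred : {pred A} := [pred x | f x == 0].

Lemma kernel_pred_closed : submod_closed kernel_pred.
Proof.
split=> [|c u v]; rewrite !inE ?linear0 // => /eqP fu /eqP fv.
by rewrite linearP fu fv scaler0 addr0.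
Qed.

HB.instance Definition _ :=
  GRing.isSubmodClosed.Build R A kernel_pred kernel_pred_closed.

Record kernel := Kernel { kernel_val : A; _ : kernel_val \in kernel_pred }.

HB.instance Definition _ := [isSub for kernel_val].
HB.instance Definition _ := [Choice of kernel by <:].
HB.instance Definition _ := [SubChoice_isSubLmodule of kernel by <:].

Lemma kernelP (x : kernel) : f (val x) = 0.
Proof. exact/eqP/(valP x). Qed.

Lemma kernel_lift (x : A) : f x = 0 -> exists y : kernel, val y = x.
Proof. by move=> /eqP fx; exists (Kernel fx). Qed.

End Kernel.

(** * Construction of linear maps, and closure properties of projective modules *)

Section LinearMaps.
Variable R : nzRingType.
Implicit Types A B C M P : lmodType R.

(** Maps are obtained by existence, so that later arguments see them only through their defining
    equation. *)
Lemma linear_of (A B : lmodType R) (h : A -> B) :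
  (forall c u v, h (c *: u + v) = c *: h u + h v) ->
  exists h' : {linear A -> B}, h' =1 h.
Proof.
move=> hlin; pose hL := GRing.isLinear.Build R A B *:%R h hlin.
by exists (HB.pack h hL : {linear A -> B}).
Qed.

Lemma kernel_factor A B C (f : {linear A -> B}) (h : {linear C -> A}) :
  (forall x, f (h x) = 0) ->
  exists h' : {linear C -> kernel f}, forall x, val (h' x) = h x.
Proof.
move=> fh0; have fh0' x : h x \in kernel_pred f by rewrite inE fh0.
have [c u v|h' h'E] := @linear_of C (kernel f) (fun x => Kernel (fh0' x)).
  by apply: val_inj; rewrite /= linearP.
by exists h' => x; rewrite h'E.
Qed.

Lemma linear_inverse A B (f : {linear A -> B}) :
  (forall a, f a = 0 -> a = 0) -> (forall b, exists a, f a = b) ->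
  exists h : {linear B -> A}, forall b, f (h b) = b.
Proof.
move=> f_inj f_surj; have [h fh] := choice f_surj.
have [c u v|h' h'E] := @linear_of B A h; last by exists h' => b; rewrite h'E.
by apply/subr0_eq/f_inj; rewrite linearB linearP !fh subrr.
Qed.

Lemma projective_retract (A B : lmodType R) (s : {linear A -> B})
    (r : {linear B -> A}) :
  (forall a, r (s a) = a) -> projective B -> projective A.
Proof.
move=> rs projB X Y f g f_surj.
have [h fh] := projB X Y f (g \o r)%FUN f_surj.
by exists (h \o s)%FUN => x /=; rewrite fh /= rs.
Qed.

Lemma projective_pair A B : projective A -> projective B ->
  projective (A * B)%type.
Proof.
move=> projA projB X Y f g f_surj.
have [c u v|gA gAE] := @linear_of A Y (fun a => g (a, 0)).
  by rewrite -linearP; congr (g (_, _)); rewrite /= scaler0 addr0.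
have [c u v|gB gBE] := @linear_of B Y (fun b => g (0, b)).
  by rewrite -linearP; congr (g (_, _)); rewrite /= scaler0 addr0.
have [hA fhA] := projA _ _ f gA f_surj.
have [hB fhB] := projB _ _ f gB f_surj.
have [c u v|h hE] := @linear_of (A * B)%type X (fun u => hA u.1 + hB u.2).
  by rewrite /= !linearP scalerDr addrACA.
exists h => -[a b]; rewrite hE linearD fhA fhB gAE gBE -linearD.
by congr (g (_, _)); rewrite /= ?addr0 ?add0r.
Qed.

Lemma projective_trivial A : (forall x : A, x = 0) -> projective A.
Proof.
move=> A0 X Y f g _; have [c u v|h hE] := @linear_of A X (fun=> 0).
  by rewrite scaler0 addr0.
by exists h => x; rewrite hE (A0 x) !linear0.
Qed.

Lemma projective_regular : projective (R^o : lmodType R).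
Proof.
move=> X Y f g f_surj; have [a fa] := f_surj (g 1).
have [c u v|h hE] := @linear_of R^o X (fun x => (x : R) *: a).
  by rewrite scalerDl scalerA.
by exists h => x; rewrite hE linearZ fa -linearZ /= [_ *: _]mulr1.
Qed.

End LinearMaps.

(** * Projective dimension through syzygies and short exact sequences *)

Section ProjectiveDimensionBound.
Variable R : nzRingType.
Implicit Types A B C M P : lmodType R.

Definition surj (A B : lmodType R) (f : A -> B) := forall b, exists a, f a = b.

(** A projective resolution of length at most [n], unfolded one syzygy at a time so that bounds
    follow by induction on [n]. *)
Fixpoint pd_le (n : nat) (M : lmodType R) : Prop :=
  if n is n'.+1 then
    exists P (p : {linear P -> M}),
      [/\ projective P, surj p & pd_le n' (kernel p)]
  else projective M.

Lemma projective_pd_le n M : projective M -> pd_le n M.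
Proof.
elim: n M => //= n IHn M projM; exists M, idfun; split=> //.
  by move=> b; exists b.
by apply/IHn/projective_trivial => x; apply/val_inj/(kernelP x).
Qed.

Lemma pd_leW m n M : (m <= n)%N -> pd_le m M -> pd_le n M.
Proof.
elim: m n M => [|m IHm] [|n] M //; first by move=> _; apply: projective_pd_le.
by move=> le_mn [P [p [projP p_surj /(IHm n)pdK]]]; exists P, p; split; auto.
Qed.

Record short_exact A B C (f : {linear A -> B}) (g : {linear B -> C}) : Prop :=
  ShortExact {
    se_inj : forall a, f a = 0 -> a = 0;
    se_surj : surj g;
    se_comp : forall a, g (f a) = 0;
    se_exact : forall b, g b = 0 -> exists a, f a = b }.

(** Since [C] is projective, [g] has a section, which identifies [B] with [A * C]. *)
Lemma projective_extension A B C (f : {linear A -> B}) (g : {linear B -> C}) :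
  short_exact f g -> projective A -> projective C -> projective B.
Proof.
case=> f_inj g_surj gf0 fg projA projC.
have [s gs] := projC _ _ g idfun g_surj.
have [c u v|h hE] := @linear_of R (A * C)%type B (fun u => f u.1 + s u.2).
  by rewrite /= !linearP scalerDr addrACA.
have [|b|h' hh'] := @linear_inverse _ _ _ h.
- case=> a c; rewrite hE /= => h0.
  have c0 : c = 0 by rewrite -[c]gs /= -[g _]add0r -(gf0 a) -linearD h0 linear0.
  by rewrite c0 linear0 addr0 in h0; rewrite c0 (f_inj _ h0).
- have [|a fa] := fg (b - s (g b)); first by rewrite linearB gs subrr.
  by exists (a, g b); rewrite hE /= fa subrK.
by apply: projective_retract hh' _; apply: projective_pair.
Qed.

(** Horseshoe lemma: [P * Q] maps onto [B], and the kernel of this map is an extension of the kernel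
    of [q] by that of [p]. *)
Lemma pd_le_extension n A B C (f : {linear A -> B}) (g : {linear B -> C}) :
  short_exact f g -> pd_le n A -> pd_le n C -> pd_le n B.
Proof.
elim: n A B C f g => [|n IHn] A B C f g; first exact: projective_extension.
case=> f_inj g_surj gf0 fg [P [p [projP p_surj pdP]]] [Q [q [projQ q_surj pdQ]]].
have [t gt] := projQ _ _ g q g_surj.
have [c u v|h hE] := @linear_of R (P * Q)%type B (fun u => f (p u.1) + t u.2).
  by rewrite /= !linearP scalerDr addrACA.
exists (P * Q)%type, h; split; first exact: projective_pair.
  move=> b; have [y qy] := q_surj (g b).
  have [|a fa] := fg (b - t y); first by rewrite linearB gt qy subrr.
  by have [x px] := p_surj a; exists (x, y); rewrite hE /= px fa subrK.
have [c u v|i0 i0E] :=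
    @linear_of R (kernel p) (P * Q)%type (fun x => (val x, 0)).
  by congr (_, _); rewrite /= scaler0 addr0.
have [x|i iE] := @kernel_factor _ _ _ _ h i0.
  by rewrite i0E hE /= kernelP !linear0 addr0.
have [c u v|j0 j0E] := @linear_of R (kernel h) Q (fun x => (val x).2).
  by [].
have [x|j jE] := @kernel_factor _ _ _ _ q j0.
  rewrite j0E -gt -[LHS]add0r -(gf0 (p (val x).1)) -linearD -hE kernelP.
  by rewrite linear0.
apply: (IHn _ _ _ i j) => //; split.
- move=> a ia0; apply: val_inj; have := congr1 val ia0.
  by rewrite iE i0E => -[].
(* [t (val y)] lies in the image of [f], so a first component can be chosen that cancels it. *)
- move=> y; have [|a fa] := fg (t (val y)); first by rewrite gt kernelP.
  have [x px] := p_surj (- a).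
  have [|z zE] := @kernel_lift _ _ _ h (x, val y).
    by rewrite hE /= px linearN fa addNr.
  by exists z; apply: val_inj; rewrite jE j0E zE.
- by move=> a; apply: val_inj; rewrite jE j0E iE i0E.
move=> b jb; have b2 : (val b).2 = 0 by rewrite -j0E -jE jb.
have pb : p (val b).1 = 0.
  by apply: f_inj; move: (kernelP b); rewrite hE b2 linear0 addr0.
have [x xE] := kernel_lift pb; exists x; apply: val_inj.
by rewrite iE i0E xE -b2; case: (val b).
Qed.

Lemma pd_le_iso n A B (f : {linear A -> B}) :
  (forall a, f a = 0 -> a = 0) -> surj f -> pd_le n A -> pd_le n B.
Proof.
move=> f_inj f_surj pdA.
have [c u v|g gE] := @linear_of R B 'rV[R]_0 (fun=> 0).
  by rewrite scaler0 addr0.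
apply: (@pd_le_extension n _ _ _ f g _ pdA); last first.
  by apply/projective_pd_le/projective_trivial => x; apply: thinmx0.
by split=> // b; exists 0; rewrite linear0 [b]thinmx0.
Qed.

(** For [n = 0] the kernel of [g] is a copy of [A]. Otherwise a projective [Q] onto [B] also maps
    onto [C], and the kernel of the composite is an extension of [A] by the kernel of [q]. *)
Lemma pd_le_cokernel n A B C (f : {linear A -> B}) (g : {linear B -> C}) :
  short_exact f g -> pd_le n A -> pd_le n B -> pd_le n.+1 C.
Proof.
case=> f_inj g_surj gf0 fg pdA.
case: n pdA => [projA projB|n pdA [Q [q [projQ q_surj pdK]]]].
  exists B, g; split=> //.
  have [f' f'E] := kernel_factor gf0.
  apply: (@pd_le_iso 0 _ _ f') projA.
    by move=> a fa0; apply: f_inj; rewrite -f'E fa0.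
  move=> b; have [a fa] := fg _ (kernelP b).
  by exists a; apply: val_inj; rewrite f'E.
exists Q, (g \o q)%FUN; split=> //.
  move=> c; have [b <-] := g_surj c; have [x <-] := q_surj b; by exists x.
have [c u v|i0 i0E] := @linear_of R (kernel q) Q val; first by [].
have [x|i iE] := @kernel_factor _ _ _ _ (g \o q)%FUN i0.
  by rewrite i0E /= kernelP linear0.
(* The map to [A] lifts [q] through [f]; injectivity of [f] makes the chosen lift linear. *)
have [|r rE] := @choice (kernel (g \o q)%FUN) A (fun x a => f a = q (val x)).
  by move=> x; apply/fg/(kernelP x).
have [c u v|j jE] := @linear_of R _ _ r.
  by apply/subr0_eq/f_inj; rewrite linearB linearP !rE /= linearP subrr.
apply: (@pd_le_extension _ _ _ _ i j) pdA; last exact: pd_leW pdK.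
split.
- by move=> a ia0; apply: val_inj; rewrite -i0E -iE ia0.
- move=> a; have [x qx] := q_surj (f a).
  have [|y yE] := @kernel_lift _ _ _ (g \o q)%FUN x; first by rewrite /= qx.
  by exists y; apply/subr0_eq/f_inj; rewrite jE linearB rE yE qx subrr.
- by move=> a; apply: f_inj; rewrite jE rE iE i0E kernelP.
move=> b jb; have qb : q (val b) = 0 by rewrite -rE -jE jb linear0.
by have [x xE] := kernel_lift qb; exists x; apply: val_inj; rewrite iE i0E.
Qed.

Lemma proj_dim_le_projective M : projective M -> proj_dim_le M 0.
Proof.
move=> projM; pose Z : lmodType R := 'rV[R]_0.
have Z0 (x : Z) : x = 0 by apply: thinmx0.
pose F i : lmodType R := if i is 0 then M else Z.
have [d dE] : exists d : forall i, {linear F i.+1 -> F i},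
    forall i x, d i x = 0.
  have dP i : exists d : {linear F i.+1 -> F i}, forall x, d x = 0.
    have [c u v|d dE] := @linear_of R (F i.+1) (F i) (fun=> 0).
      by rewrite scaler0 addr0.
    by exists d.
  by exists (fun i => projT1 (cid (dP i))) => i; apply: (projT2 (cid (dP i))).
have Fproj i : projective (F i) by case: i => //= i; apply: projective_trivial.
unshelve eexists (@ProjResolution R M F d idfun Fproj _ _ _).
- by move=> m; exists m.
- move=> x; split=> [/= ->|[y <-]]; last by rewrite dE.
  by exists 0; rewrite linear0.
- by move=> i x; split=> [_|_]; [exists 0; rewrite [x]Z0 linear0|rewrite dE].
by case.
Qed.

(** [P] is spliced in front of a resolution of the kernel of [p]; the new first differential is the
    old augmentation followed by the inclusion. *)
Lemma pd_le_proj_dim_le n M : pd_le n M -> proj_dim_le M n.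
Proof.
elim: n M => [|n IHn] M; first exact: proj_dim_le_projective.
case=> P [p [projP p_surj /IHn[[F d a Fproj a_surj ex0 exS] Flen]]].
have [c u v|i iE] := @linear_of R (kernel p) P val; first by [].
pose F' j : lmodType R := if j is j'.+1 then F j' else P.
pose d' j : {linear F' j.+1 -> F' j} :=
  match j with 0 => (i \o a)%FUN | j'.+1 => d j' end.
have F'proj j : projective (F' j) by case: j.
unshelve eexists (@ProjResolution R M F' d' p F'proj p_surj _ _).
- move=> x; split=> [px0|[y <-]]; last by rewrite /= iE kernelP.
  have [z <-] := kernel_lift px0; have [y <-] := a_surj z.
  by exists y; rewrite /= iE.
- case=> [|j] x /=; last exact: exS.
  rewrite -ex0 iE; split=> [ax0|->//]; exact: val_inj.
by case=> // j lt_nj x; apply: (Flen j).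
Qed.

End ProjectiveDimensionBound.

(** * Maps between quotient modules, and the colon sequence *)

Section Quotients.

Lemma quotmod_map (R : nzRingType) (V W : lmodType R) (I : submodClosed V)
    (J : submodClosed W) (h : {linear V -> W}) :
  (forall v, v \in I -> h v \in J) ->
  exists h' : {linear quotmod I -> quotmod J},
    forall v, h' (quotmod_proj I v) = quotmod_proj J (h v).
Proof.
move=> hIJ; have [r rK] := choice (@quotmod_proj_surj _ _ I).
have [c u v|h' h'E] :=
    @linear_of R (quotmod I) (quotmod J) (fun x => quotmod_proj J (h (r x))).
  rewrite -!linearP; apply/quotmod_projP; rewrite -linearB; apply: hIJ.
  by apply/quotmod_projP; rewrite rK linearP /= !rK.
exists h' => v; rewrite h'E; apply/quotmod_projP; rewrite -linearB; apply: hIJ.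
by apply/quotmod_projP; rewrite rK.
Qed.

Lemma quotmod_proj_eq0 (R : nzRingType) (V : lmodType R) (I : submodClosed V) v :
  quotmod_proj I v = 0 <-> v \in I.
Proof. by rewrite -[v in v \in I]subr0 -quotmod_projP linear0. Qed.

Lemma pd_le_quotmod_eq (R : nzRingType) (V : lmodType R)
    (I J : submodClosed V) n :
  I =i J -> pd_le n (quotmod I) -> pd_le n (quotmod J).
Proof.
move=> eqIJ; have [v|h hE] := @quotmod_map _ _ _ I J idfun.
  by rewrite /= eqIJ.
apply: (@pd_le_iso _ _ _ _ h) => [a|b].
  have [v <-] := quotmod_proj_surj a.
  by rewrite hE !quotmod_proj_eq0 eqIJ.
by have [v <-] := quotmod_proj_surj b; exists (quotmod_proj I v); rewrite hE.
Qed.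

(** The hypotheses say that [C] is [I : x] and [J] is [I + (x)]. Multiplication by [x] embeds [R/C]
    in [R/I] with image [J/I]. *)
Lemma colon_short_exact (R : comNzRingType) (x : R) (I C J : submodClosed R^o) :
  (forall p : R^o, (p \in C) = ((x * p : R^o) \in I)) ->
  (forall p, p \in I -> p \in J) -> (x : R^o) \in J ->
  (forall p : R^o, p \in J -> exists b : R, (p - x * b : R^o) \in I) ->
  exists (f : {linear quotmod C -> quotmod I})
         (g : {linear quotmod I -> quotmod J}), short_exact f g.
Proof.
move=> CE IJ xJ JE.
have [c u v|mx mxE] := @linear_of R R^o R^o (fun p : R => x * p).
  by rewrite /= mulrDr; congr (_ + _); rewrite [LHS]mulrCA.
have [p|f fE] := @quotmod_map _ _ _ C I mx; first by rewrite mxE CE.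
have [//|g gE] := @quotmod_map _ _ _ I J idfun.
exists f, g; split.
- move=> a; have [p <-] := quotmod_proj_surj a.
  by rewrite fE mxE !quotmod_proj_eq0 CE.
- by move=> b; have [p <-] := quotmod_proj_surj b; exists (quotmod_proj I p).
- move=> a; have [p <-] := quotmod_proj_surj a.
  rewrite fE gE mxE quotmod_proj_eq0 /= mulrC.
  exact: (@rpredZ _ _ J p x).
- move=> b; have [p <-] := quotmod_proj_surj b.
  rewrite gE quotmod_proj_eq0 => /JE[q pq]; exists (quotmod_proj C q).
  rewrite fE mxE; apply/quotmod_projP.
  by rewrite -[_ - _]opprB -scaleN1r; apply: rpredZ.
Qed.

End Quotients.

(** * Monomial ideals as up-closed sets of exponents *)

Section MonomialIdeals.
Variables (k : fieldType) (n : nat).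
Local Notation S := {mpoly k[n]}.

Record up_closed := UpClosed {
  up_pred :> 'X_{1..n} -> bool;
  up_closedP : forall m m', up_pred m -> up_pred (m + m')%MM }.

(** Equality, rather than equivalence, lets one description of an ideal replace another inside the
    type of a quotient module. *)
Lemma up_closed_ext (P Q : up_closed) : P =1 Q -> P = Q.
Proof.
case: P Q => [P Pup] [Q Qup] /funext/= PQ.
by case: _ / PQ Qup => Qup; rewrite (Prop_irrelevance Pup Qup).
Qed.

Variable Q : up_closed.

(** A polynomial lies in a monomial ideal exactly when all its monomials do, so the exponent set
    determines the ideal. *)
Definition mon_ideal : {pred S^o} := [pred p : S^o | all Q (msupp (p : S))].

Lemma mon_idealP (p : S) :
  reflect (forall m, m \in msupp p -> Q m) ((p : S^o) \in mon_ideal).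
Proof. exact: allP. Qed.

Lemma mon_ideal_closed : submod_closed mon_ideal.
Proof.
split=> [|c u v /mon_idealP uQ /mon_idealP vQ]; first by rewrite inE msupp0.
apply/mon_idealP => m /msuppD_le; rewrite mem_cat => /orP[|/vQ//].
move=> /msuppM_le/allpairsP[[m1 m2] /= [_ /uQ Qm2 ->]].
by rewrite addmC up_closedP.
Qed.

HB.instance Definition _ :=
  GRing.isSubmodClosed.Build S S^o mon_ideal mon_ideal_closed.

Definition mon_quot : lmodType S := quotmod mon_ideal.

End MonomialIdeals.

(** * The colon sequence of a monomial ideal and a variable *)

Section MonomialSequence.
Variables (k : fieldType) (n : nat) (i : 'I_n) (Q : up_closed n).
Local Notation S := {mpoly k[n]}.

Lemma up_colon_closed m m' : Q (m + U_(i))%MM -> Q (m + m' + U_(i))%MM.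
Proof.
by move=> Qm; rewrite -addmA [(m' + _)%MM]addmC addmA; apply: up_closedP.
Qed.

(** The monomials of [I : X_i]; those of [I + (X_i)] are given by [up_add]. *)
Definition up_colon := UpClosed up_colon_closed.

Lemma up_add_closed m m' :
  Q m || (0 < m i)%N -> Q (m + m')%MM || (0 < (m + m')%MM i)%N.
Proof.
rewrite mnmDE => /orP[Qm|mi]; apply/orP; first by left; apply: up_closedP.
by right; apply: ltn_addr.
Qed.

Definition up_add := UpClosed up_add_closed.

Lemma mon_short_exact :
  exists (f : {linear mon_quot k up_colon -> mon_quot k Q})
         (g : {linear mon_quot k Q -> mon_quot k up_add}), short_exact f g.
Proof.
apply: (@colon_short_exact S 'X_i).
- move=> p; rewrite !inE mulrC (perm_all _ (msuppMX p _)) [RHS]all_map.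
 by apply: eq_all => m /=; rewrite addmC.
- move=> p /mon_idealP pQ; apply/mon_idealP => m /pQ; by rewrite /= => ->.
- by rewrite inE msuppX /= mnm1E eqxx orbT.
move=> p /mon_idealP; rewrite {2}(mpolyE p).
(* The witness is built term by term: a term in [I] adds nothing to [b], and any other is divisible
   by [X_i] and adds its quotient. *)
elim: (msupp p) => [|m s IHs] sQ.
  by exists 0; rewrite big_nil mulr0 subr0 inE msupp0.
have [|b bQ] := IHs; first by move=> m' sm'; rewrite sQ // inE sm' orbT.
rewrite big_cons; have /orP[Qm|mi] := sQ m (mem_head m s).
  exists b; rewrite -addrA; apply: rpredD bQ.
  apply/mon_idealP => m' /msuppZ_le; by rewrite msuppX inE => /eqP->.
exists (p@_m *: 'X_[m - U_(i)] + b).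
suff -> : p@_m *: 'X_[m] = 'X_i * (p@_m *: 'X_[m - U_(i)]) :> S.
  by rewrite mulrDr opprD addrACA subrr add0r.
rewrite -scalerAr -mpolyXD addmC submK //.
by apply/mnm_lepP => j; rewrite mnm1E; case: eqP => [<-|].
Qed.

End MonomialSequence.

(** * Ideals generated by killed variables and live edges *)

Section GraphIdeals.
Variables (k : fieldType) (T : finType) (e : rel T).
Hypotheses (e_sym : symmetric e) (e_irr : irreflexive e).
Implicit Types (Z W X N : {set T}) (m : 'X_{1..#|T|}).

(** Only positivity of exponents is tested, since for loopless [e] the generators are squarefree. *)
Definition graph_pred Z W m : bool :=
  [exists z in Z, 0 < m (enum_rank z)]%N ||
  [exists x in W, exists y in W,
     [&& e x y, 0 < m (enum_rank x) & 0 < m (enum_rank y)]]%N.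

Lemma graph_predP Z W m :
  reflect ((exists2 z, z \in Z & (0 < m (enum_rank z))%N) \/
           exists x y, [/\ x \in W, y \in W, e x y, (0 < m (enum_rank x))%N
                         & (0 < m (enum_rank y))%N])
          (graph_pred Z W m).
Proof.
apply: (iffP orP) => -[].
- by case/exists_inP=> z; left; exists z.
- by case/exists_inP=> x xW /exists_inP[y yW /and3P[]]; right; exists x, y.
- by case=> z; left; apply/exists_inP; exists z.
case=> x [y [xW yW exy mx my]]; right; apply/exists_inP; exists x => //.
by apply/exists_inP; exists y; rewrite ?exy ?mx.
Qed.

Lemma graph_pred_closed Z W m m' :
  graph_pred Z W m -> graph_pred Z W (m + m')%MM.
Proof.
have pos i : (0 < m i)%N -> (0 < (m + m')%MM i)%N.
  by rewrite mnmDE; apply: ltn_addr.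
case/graph_predP=> [[z zZ /pos mz]|[x [y [xW yW exy /pos mx /pos my]]]].
  by apply/graph_predP; left; exists z.
by apply/graph_predP; right; exists x, y.
Qed.

Definition graph_up Z W := UpClosed (@graph_pred_closed Z W).

(* S / ((z : z \in Z) + I(G[W])) *)
Definition graph_quot Z W : lmodType {mpoly k[#|T|]} :=
  mon_quot k (graph_up Z W).

Definition nbh x : {set T} := [set z | e x z].

Lemma graph_predD1_isolated Z W y : [disjoint nbh y & W] ->
  graph_pred Z (W :\ y) =1 graph_pred Z W.
Proof.
move=> /pred0P yW m; apply/graph_predP/graph_predP=> -[|[a [b []]]]; first by left.
- by rewrite !inE => /andP[_ aW] /andP[_ bW] *; right; exists a, b.
- by left.
move=> aW bW eab ma mb; right; exists a, b; rewrite !inE aW bW; split=> //.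
  rewrite andbT; apply/eqP => ay; have := yW b.
  by rewrite /= inE -ay eab bW.
rewrite andbT; apply/eqP => ay; have := yW a.
by rewrite /= inE -ay e_sym eab aW.
Qed.

(** The new generator [x] absorbs every edge at [x]. *)
Lemma graph_pred_add Z W x :
  up_add (enum_rank x) (graph_up Z W) =1 graph_pred (x |: Z) (W :\ x).
Proof.
move=> m; rewrite /=; apply/orP/graph_predP.
  case=> [/graph_predP[[z zZ mz]|[a [b [aW bW eab ma mb]]]]|mx]; last first.
  - by left; exists x; rewrite ?setU11.
  - have [ax|ax] := eqVneq a x; first by left; exists a; rewrite // ax setU11.
    have [bx|bx] := eqVneq b x; first by left; exists b; rewrite // bx setU11.
    by right; exists a, b; rewrite !inE ax bx.
  - by left; exists z; rewrite // setU1r.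
case=> [[z]|[a [b [/setD1P[_ aW] /setD1P[_ bW] eab ma mb]]]].
  case/setU1P=> [-> mx|zZ mz]; [by right|left].
  by apply/graph_predP; left; exists z.
by left; apply/graph_predP; right; exists a, b.
Qed.

(** In the colon an edge [xz] becomes the generator [z], which absorbs the other edges at [z]; then
    no edge at [x] remains. The condition on [Z] keeps the colon from being the whole ring. *)
Lemma graph_pred_colon Z W x : x \in W -> x \notin Z ->
  up_colon (enum_rank x) (graph_up Z W) =1
    graph_pred (Z :|: (nbh x :&: W)) (W :\: (x |: nbh x)).
Proof.
move=> xW xZ m; rewrite /=.
have posE y : y != x ->
    (0 < (m + U_(enum_rank x))%MM (enum_rank y) = (0 < m (enum_rank y)))%N.
  by move=> yx; rewrite mnmDE mnm1E (inj_eq enum_rank_inj) eq_sym (negPf yx) addn0.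
have posx : (0 < (m + U_(enum_rank x))%MM (enum_rank x))%N.
  by rewrite mnmDE mnm1E eqxx addn1.
have memx z : z \in Z -> z != x by apply: contraTneq => ->.
have edgex z : e x z -> z != x by apply: contraTneq => ->; rewrite e_irr.
apply/graph_predP/graph_predP.
  case=> [[z zZ]|[a [b [aW bW eab]]]].
    by rewrite posE ?memx // => mz; left; exists z; rewrite // inE zZ.
  have nbhW z : e x z -> z \in W -> (0 < m (enum_rank z))%N ->
      exists2 z, z \in Z :|: (nbh x :&: W) & (0 < m (enum_rank z))%N.
    by move=> exz zW mz; exists z; rewrite // !inE exz zW orbT.
  have [ax|ax] := eqVneq a x.
    rewrite ax in eab; rewrite (posE b) ?edgex // => _ mb.
    by left; apply: nbhW mb.
  have [bx|bx] := eqVneq b x.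
    rewrite bx e_sym in eab; rewrite (posE a) // => ma _.
    by left; apply: nbhW ma.
  rewrite !posE // => ma mb.
  case exa: (e x a); first by left; apply: nbhW ma.
  case exb: (e x b); first by left; apply: nbhW mb.
  by right; exists a, b; rewrite !inE exa exb (negPf ax) (negPf bx) aW bW.
case=> [[z]|[a [b []]]].
  case/setUP=> [zZ mz|]; first by left; exists z; rewrite // posE ?memx.
  case/setIP; rewrite inE => exz zW mz; right; exists x, z.
  by split; rewrite // posE ?edgex.
rewrite !inE => /andP[/norP[ax _] aW] /andP[/norP[bx _] bW] eab ma mb.
by right; exists a, b; rewrite !posE.
Qed.

Lemma graph_short_exact Z W x : x \in W -> x \notin Z ->
  exists (f : {linear graph_quot (Z :|: (nbh x :&: W)) (W :\: (x |: nbh x)) ->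
                      graph_quot Z W})
         (g : {linear graph_quot Z W -> graph_quot (x |: Z) (W :\ x)}),
  short_exact f g.
Proof.
move=> xW xZ.
have := mon_short_exact k (enum_rank x) (graph_up Z W).
have -> : up_add (enum_rank x) (graph_up Z W) = graph_up (x |: Z) (W :\ x).
  exact/up_closed_ext/graph_pred_add.
suff -> : up_colon (enum_rank x) (graph_up Z W) =
  graph_up (Z :|: (nbh x :&: W)) (W :\: (x |: nbh x)) by [].
exact/up_closed_ext/graph_pred_colon.
Qed.

Lemma graph_quot_isolated Z W y : [disjoint nbh y & W] ->
  graph_quot Z (W :\ y) = graph_quot Z W.
Proof.
by move=> yW; congr mon_quot; apply/up_closed_ext/graph_predD1_isolated.
Qed.

(** For [x] in [Z], [S/(Z)] is the cokernel of multiplication by [x] on [S/(Z :\ x)], so each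
    variable raises the bound by at most one. *)
Lemma pd_le_variables Z n : (#|Z| <= n)%N -> pd_le n (graph_quot Z set0).
Proof.
have [c] := ubnP #|Z|; elim: c => // c IHc in Z n *.
have [->|[x xZ]] := set_0Vmem Z.
  move=> _ _; apply: pd_leW (leq0n n) _.
  (* Without generators the ideal is zero and the quotient is [S] itself. *)
  apply: (@pd_le_iso _ 0 _ _ (quotmod_proj (@mon_ideal k _ (graph_up set0 set0)))).
  - move=> p /quotmod_proj_eq0/mon_idealP p0; apply/msuppnil0.
    case: (msupp p) p0 => // m s /(_ m (mem_head m s)).
    by case/graph_predP=> [[z]|[a [b []]]]; rewrite inE.
  - exact: quotmod_proj_surj.
  exact: projective_regular.
rewrite (cardsD1 x) xZ; case: n => // n lt_c le_n.
have pdZ := IHc (Z :\ x) n lt_c le_n.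
have xZx : x \notin Z :\ x by rewrite setD11.
have xnx : [disjoint nbh x & [set x]] by rewrite disjoint_sym disjoints1 inE e_irr.
(* With [x] as only live vertex there is no edge, so the first two terms of the
   sequence are both [S / (Z :\ x)]. *)
have := graph_short_exact (set11 x) xZx.
have -> : [set x] :\: (x |: nbh x) = set0.
  by apply/setP => z; rewrite !inE; case: (z == x); rewrite ?andbF.
rewrite (disjoint_setI0 xnx) setU0 -(graph_quot_isolated (Z :\ x) xnx).
rewrite setDv setD1K // => -[f [g fg]]; exact: pd_le_cokernel fg _ _.
Qed.

(** * The bound for killed and live sets when edge degrees are at most [D] *)

Variable D : nat.
Hypotheses (D_gt0 : (0 < D)%N).
Hypothesis D_edge : forall x y, e x y -> (#|nbh x :|: nbh y| <= D)%N.

(** The inequality is [|Z| + |W| (1 - 1/D) < n + 1] with the denominator cleared: [n] is at least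
    the floor of the left side. *)
Lemma pd_le_graph_quot Z W n : [disjoint Z & W] ->
  ((#|Z| + #|W|) * D < n.+1 * D + #|W|)%N -> pd_le n (graph_quot Z W).
Proof.
have [c] := ubnP #|W|; elim: c => // c IHc in Z W n *.
have [->|[y yW]] := set_0Vmem W.
  move=> _ _; rewrite cards0 !addn0 ltn_pmul2r // ltnS; exact: pd_le_variables.
rewrite ltnS => leWc disZW bound; pose N := nbh y :&: W.
(* [X] collects the neighbours of [y] killed so far. The inner induction is on the number of live
   neighbours that remain. *)
suff pdX X : X \subset N -> pd_le n (graph_quot (X :|: Z) (W :\: X)).
  by have := pdX set0 (sub0set _); rewrite set0U setD0.
have [d] := ubnP #|N :\: X|; elim: d => // d IHd in X *.
rewrite ltnS => leNd subXN.
have subXW : X \subset W := subset_trans subXN (subsetIr _ _).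
have subXy : X \subset nbh y := subset_trans subXN (subsetIl _ _).
have disXZ : X :&: Z = set0.
  by apply: disjoint_setI0; rewrite disjoint_sym; apply: disjointWr disZW.
have cardXZ : #|X :|: Z| = (#|X| + #|Z|)%N by rewrite cardsU disXZ cards0 subn0.
have cardW : #|W| = (#|X| + #|W :\: X|)%N.
  by rewrite -(cardsID X W) (setIidPr subXW).
have [NX|[x]] := set_0Vmem (N :\: X).
  have XE : X = N by apply/eqP; rewrite eqEsubset subXN -setD_eq0 NX eqxx.
  have yNX : y \notin X by rewrite XE !inE e_irr.
  have isoy : [disjoint nbh y & W :\: X].
    rewrite XE -setI_eq0; apply/eqP/setP => z; rewrite !inE.
    by case: (e y z); case: (z \in W).
  have ltXD : (#|X| < D)%N.
    (* For [x] in [X], both [y] and [X] lie in [N(x) U N(y)]; for empty [X], positivity of [D]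
       suffices. *)
    have [->|[x xX]] := set_0Vmem X; first by rewrite cards0.
    have eyx : e y x by have := subsetP subXy x xX; rewrite inE.
    apply: leq_trans (D_edge eyx).
    have <- : #|y |: X| = #|X|.+1 by rewrite cardsU1 yNX.
    apply/subset_leq_card/subsetP => z /setU1P[->|/(subsetP subXy)].
      by rewrite !inE e_sym eyx orbT.
    by rewrite !inE => ->.
  have := cardsD1 y (W :\: X); rewrite !inE yNX yW add1n => cardWX.
  rewrite -(graph_quot_isolated _ isoy); apply: IHc; first by lia.
    apply/pred0P => z; rewrite /= !inE.
    have /pred0P/(_ z) /= := disZW.
    by case: (z \in X); case: (z \in W); rewrite ?andbF ?andbT //= => ->.
  (* The left side of the bound falls by [D], the right side only by [|X| + 1 <= D]. *)
  by rewrite cardXZ; nia.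
rewrite !inE => /andP[xX /andP[eyx xW]].
have xWX : x \in W :\: X by rewrite inE xX.
have xXZ : x \notin X :|: Z.
  rewrite inE negb_or xX /=; apply: contraL xW => xZ.
  by rewrite (disjointFr disZW).
(* The colon term has fewer live vertices and falls under the outer induction; the other term falls
   under the inner one. *)
have [f [g fg]] := graph_short_exact xWX xXZ; apply: (pd_le_extension fg).
  set V := W :\: X in xWX *; set N' := nbh x :&: V.
  rewrite -/V in cardW.
  have VN : V :&: (x |: nbh x) = x |: N'.
    by rewrite setIUr [V :&: nbh x]setIC (setIidPr _) // sub1set.
  have xN : x \notin N' by rewrite !inE e_irr.
  have cardV := cardsID (x |: nbh x) V; rewrite VN cardsU1 xN add1n in cardV.
  (* [X], [x] and [N'] are disjoint parts of [N(x) U N(y)]: the first two lie in [N(y)], the last in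
     [N(x)]. *)
  have cardD : (#|X| + #|N'| < D)%N.
    apply: leq_trans (D_edge eyx).
    have disX : X :&: (x |: N') = set0.
      apply/setP => z; rewrite !inE; have [->|_] := eqVneq z x.
        by rewrite (negPf xX).
      by case: (z \in X); rewrite ?andbF.
    have <- : #|X :|: (x |: N')| = (#|X| + #|N'|).+1.
      by rewrite cardsU disX cards0 subn0 cardsU1 xN add1n addnS.
    apply/subset_leq_card; rewrite !subUset (subset_trans subXy) ?subsetUl //.
    rewrite sub1set !inE eyx /=; apply: subset_trans (subsetUr _ _).
    exact: subsetIl.
  apply: IHc; first by lia.
    apply/pred0P => z; rewrite /= !inE.
    have /pred0P/(_ z) /= := disZW.
    by case: (z \in X); case: (z \in W); case: (e x z);
      rewrite ?andbF ?andbT ?orbF ?orbT //= => ->.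
  have : (#|X :|: Z :|: N'| <= #|X| + #|Z| + #|N'|)%N.
    by rewrite -cardXZ cardsU leq_subr.
  by nia.
(* Killing [x] moves it into [X], leaving one live neighbour of [y] fewer. *)
rewrite setDDl setUA [X :|: [set x]]setUC; apply: IHd.
  have xNX : x \in N :\: X by rewrite !inE xX eyx.
  by move: leNd; rewrite (cardsD1 x) xNX setDDl setUC.
by rewrite subUset subXN sub1set !inE eyx xW.
Qed.

(** Each monomial of the exponent set is a multiple of some edge generator, and each edge generator
    is such a monomial. *)
Lemma edge_ideal_mon : mon_ideal (graph_up set0 setT) =i edge_ideal k e.
Proof.
move=> p; apply/idP/idP => [/mon_idealP pQ|].
  rewrite (mpolyE (p : {mpoly k[_]})) big_seq.
  apply: (@big_ind _ (fun q => (q : (vpoly k T)^o) \in edge_ideal k e)).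
  - exact: (rpred0 (edge_ideal k e)).
  - by move=> q r; apply: (@rpredD _ (edge_ideal k e)).
  move=> m /pQ/graph_predP[[z]|[x [y [_ _ exy mx my]]]]; first by rewrite inE.
  have xy : enum_rank x != enum_rank y.
    by rewrite (inj_eq enum_rank_inj); apply: contraTneq exy => ->; rewrite e_irr.
  pose u := (U_(enum_rank x) + U_(enum_rank y))%MM.
  (* Since [x] and [y] differ, the exponents of [u] are at most one. *)
  have le_um : (u <= m)%MM.
    apply/mnm_lepP => i; rewrite mnmDE !mnm1E.
    have [<-|_] := eqVneq (enum_rank x) i; first by rewrite eq_sym (negPf xy).
    by have [<-|] := eqVneq (enum_rank y) i.
  have mE : 'X_[m] = 'X_[m - u] * (vvar k x * vvar k y) :> {mpoly k[#|T|]}.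
    by rewrite /vvar -!mpolyXD submK.
  apply/asboolP; exists [:: (p@_m *: 'X_[m - u], vvar k x * vvar k y)]; split.
    by move=> a; rewrite inE => /eqP->; exists x, y.
  by rewrite big_seq1 mE [LHS](@scalerAl k {mpoly k[#|T|]}).
move=> /asboolP[s [Gs ->]].
rewrite big_seq; apply: (rpred_sum (S := mon_ideal (graph_up set0 setT))).
move=> a /Gs[x [y [exy ->]]]; apply: rpredZ.
apply/mon_idealP => m; rewrite -mpolyXD msuppX inE => /eqP->.
apply/graph_predP; right; exists x, y.
by rewrite !inE !mnmDE !mnm1E !eqxx addn1 add1n.
Qed.

End GraphIdeals.

(** * From edge degrees to the rational bound *)

Lemma card_nbhU (T : finType) (e : rel T) x y :
  #|nbh e x :|: nbh e y| = edge_degree e x y.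
Proof.
rewrite cardsU /edge_degree /deg; congr (_ - _)%N.
by apply: eq_card => z; rewrite !inE.
Qed.

Theorem theorem5p3 (k : fieldType) (T : finType) (e : rel T)
    (e_sym : symmetric e) (e_irr : irreflexive e)
    (e_edge : exists x y : T, e x y) :
  exists p : nat, is_proj_dim (edge_quot k e) p /\
    p%:R <= #|T|%:R * (1 - 1 / (max_edge_degree e)%:R) :> rat.
Proof.
set D := max_edge_degree e.
have D_edge x y : e x y -> (#|nbh e x :|: nbh e y| <= D)%N.
  rewrite card_nbhU => exy.
  exact: (@leq_bigmax_cond _ _ (fun p => edge_degree e p.1 p.2) (x, y)).
have D_gt0 : (0 < D)%N.
  have [x [y exy]] := e_edge; apply: leq_trans (D_edge x y exy).
  by rewrite card_gt0; apply/set0Pn; exists y; rewrite !inE exy.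
(* The floor of [#|T| (1 - 1/D)]; the subtraction does not truncate because [D] is positive. *)
pose q := ((#|T| * D - #|T|) %/ D)%N.
have pdq : proj_dim_le (edge_quot k e) q.
  apply/pd_le_proj_dim_le/(pd_le_quotmod_eq (@edge_ideal_mon k T e e_irr)).
  apply: (pd_le_graph_quot k e_sym e_irr D_gt0 D_edge).
    by rewrite disjoints_subset sub0set.
  have := ltn_ceil (#|T| * D - #|T|) D_gt0.
  by rewrite -/q cards0 cardsT add0n; lia.
(* The projective dimension is the least resolution length, which exists because [q] bounds one. *)
have exP : exists n, `[< proj_dim_le (edge_quot k e) n >].
  by exists q; apply/asboolP.
have [p /asboolP pdp p_min] := ex_minnP exP.
exists p; split; first by split=> // m /asboolP/p_min.
have le_pq : (p <= q)%N by apply/p_min/asboolP.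
have D0 : 0 < D%:R :> rat by rewrite ltr0n.
(* Multiplying by [D] turns the claim into [p * D <= #|T| * D - #|T|] over the naturals. *)
rewrite mulrBr mulr1 mul1r -(ler_pM2r D0) mulrBl mulfVK ?lt0r_neq0 //.
rewrite -!natrM -natrB ?leq_pmulr // ler_nat.
by apply: leq_trans (leq_mul le_pq (leqnn D)) (leq_divM _ _).
Qed.
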